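(* Let $\mu$ be a finite Borel measure on $[0,1)$ such that there is a Bessel sequence $\{g_n\}_{n=-\infty}^{\infty}$ in $L^2(\mu)$ that is dextrodual to $\{e^{2\pi i n x}\}_{n=-\infty}^{\infty}$ in $L^2(\mu)$. Then for all $f\in L^2(\mu)$, $$A_{g_n}(f)(re^{2\pi i\theta})\to f$$ in $L^2(\mu)$ (as functions of $\theta\in[0,1)$) as $r\to 1^-$.
   Context: A sequence $\{g_n\}$ in a Hilbert space $H$ is a Bessel sequence if there is $B>0$ with $\sum_n|\langle f,g_n\rangle|^2\le B\|f\|^2$ for all $f\in H$. A sequence $\{g_n\}$ is dextrodual to a sequence $\{x_n\}$ in $H$ if for all $x\in H$, $x=\sum_n\langle x,g_n\rangle x_n$, with (possibly conditional) convergence in norm; for sequences indexed by $\mathbb Z$ the sum is the limit of the symmetric partial sums $\sum_{n=-M}^{M}$ as $M\to\infty$. For a Bessel sequence $\{g_n\}_{n=-\infty}^\infty$ in $H$, the map $A_{g_n}$ from $H$ to $h^2(\mathbb D)$ (the complex-valued harmonic functions on the unit disk $\mathbb D$ with square-summable coefficients) is defined by $A_{g_n}(f)(re^{2\pi i\theta})=\sum_{n=-\infty}^{\infty}\langle f,g_n\rangle r^{|n|}e^{2\pi i n\theta}$ for $0\le r<1$. *)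

(* Defs.v *)
From HB Require Import structures.
From mathcomp Require Import all_boot all_order all_algebra.
From mathcomp Require Import complex.
From mathcomp Require Import all_classical all_reals all_analysis.

Set Implicit Arguments.
Unset Strict Implicit.
Unset Printing Implicit Defensive.

Import Order.TTheory GRing.Theory Num.Theory.
Import numFieldNormedType.Exports.

Local Open Scope classical_set_scope.
Local Open Scope ring_scope.
Local Open Scope complex_scope.

Section ComplexL2.
Context (d : measure_display) (T : measurableType d) (R : realType).
Variable mu : {measure set T -> \bar R}.
Implicit Types (f h : T -> R[i]) (g x : int -> T -> R[i]).

Definition normL2 f : \bar R :=
  ('N[mu]_2%:E[(fun t => (ComplexField.Normc.normc (f t))%:E)])%E.

(* R[i] carries no sigma-algebra in the library: Borel measurability of a
   complex-valued function is measurability of its two components.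
   Elements of L^2 are represented by functions, not by classes modulo
   a.e. equality; every notion below is invariant under a.e. equality. *)
Definition inL2 f : Prop :=
  [/\ measurable_fun [set: T] (fun t => complex.Re (f t)),
      measurable_fun [set: T] (fun t => complex.Im (f t)) &
      (normL2 f < +oo)%E].

Definition cintegral f : R[i] :=
  (\int[mu]_t complex.Re (f t)) +i* (\int[mu]_t complex.Im (f t)).

Definition innerL2 f h : R[i] := cintegral (fun t => f t * (h t)^*).

Definition cvgL2 (I : Type) (F : set_system I) (u : I -> T -> R[i]) f : Prop :=
  [/\ \forall i \near F, inL2 (u i), inL2 f &
      normL2 (fun t => u i t - f t) @[i --> F] --> 0%E].

(* \sum_(n = -M)^M u n *)
Definition symsum (V : zmodType) (u : int -> V) (M : nat) : V :=
  \sum_(0 <= k < M.*2.+1) u (k%:Z - M%:Z).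

Definition bessel g : Prop :=
  exists2 B : R, 0 < B & forall f, inL2 f ->
    (\esum_(n in [set: int])
        ((ComplexField.Normc.normc (innerL2 f (g n))) ^+ 2)%:E
      <= B%:E * normL2 f ^+ 2)%E.

Definition dextrodual g x : Prop :=
  forall f, inL2 f ->
    cvgL2 \oo (fun M t => symsum (fun n => innerL2 f (g n) * x n t) M) f.

End ComplexL2.

Definition expi {R : realType} (n : int) (t : R) : R[i] :=
  cos (2 * pi * n%:~R * t) +i* sin (2 * pi * n%:~R * t).

(* A_g f at the point r e^{2 pi i t} of the disk *)
Definition Amap {d : measure_display} {T : measurableType d} {R : realType}
    (mu : {measure set T -> \bar R}) (g : int -> T -> R[i]) (f : T -> R[i])
    (r t : R) : R[i] :=
  lim ((symsum (fun n => innerL2 mu f (g n) * (r ^+ `|n|%N)%:C * expi n t) M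
          : R[i]^o) @[M --> \oo]).

(* Main.v *)
(** By Abel summation, the N-th partial sum of the power series defining [A_g f]
    at radius r is the convex combination
    [(1 - r) S_0 + (1 - r) r S_1 + ... + (1 - r) r^(N-1) S_(N-1) + r^N S_N]
    of the symmetric partial sums [S_M] of the dextrodual expansion of f.  By
    convexity of the squared modulus, its squared L^2-distance to f is at most the
    same combination of the numbers [||S_M - f||^2], which tend to 0.  The Bessel
    condition bounds the coefficients, hence the power series converges at every
    point when r < 1; Fatou's lemma passes to the limit in N, and letting r tend
    to 1 kills the weight of the first few terms. *)
Require Import Defs.
From HB Require Import structures.
From mathcomp Require Import all_boot all_order all_algebra.
From mathcomp Require Import complex.
From mathcomp Require Import all_classical all_reals all_analysis.
From mathcomp Require Import measurable_realfun zify ring lra.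
Import Order.TTheory GRing.Theory Num.Theory.
Import numFieldNormedType.Exports.
Local Open Scope classical_set_scope.
Local Open Scope ring_scope.

(** * Abel means: summation by parts and real estimates *)

(* [sum_(k < N) (1 - r) r^k d_k + r^N d_N] *)
Definition abel_mean {K : comNzRingType} (r : K) :=
  fix mean (d : nat -> K) (N : nat) : K :=
    if N is N'.+1 then (1 - r) * d 0 + r * mean (fun k => d k.+1) N' else d 0.

Section AbelMeanRing.
Context {K : comNzRingType}.
Implicit Types (r : K) (d a : nat -> K).

(** The weights sum to 1, so a constant passes through the mean. *)
Lemma abel_meanDl r x d N :
  abel_mean r (fun k => x + d k) N = x + abel_mean r d N.
Proof. by elim: N d => //= N IH d; rewrite IH; ring. Qed.

(** Summation by parts, one term at a time: after [a 0] is removed, the remaining partial sums are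
    those of the shifted sequence raised by [a 0], and [abel_meanDl] extracts this constant. *)
Lemma abel_mean_sum r a N :
  \sum_(k < N.+1) r ^+ k * a k = abel_mean r (fun M => \sum_(k < M.+1) a k) N.
Proof.
elim: N a => [|N IH] a /=; first by rewrite !big_ord1 expr0 mul1r.
rewrite big_ord_recl/= expr0 mul1r big_ord1.
under eq_bigr do rewrite exprS -mulrA.
rewrite -mulr_sumr (IH (fun k => a k.+1)).
have -> : (fun k => \sum_(i < k.+2) a i) =
          (fun k => a 0 + \sum_(i < k.+1) a i.+1).
  by apply/funext => k; rewrite big_ord_recl.
by rewrite abel_meanDl; ring.
Qed.

End AbelMeanRing.

Section AbelMeanReal.
Context {R : realFieldType}.
Implicit Types (r : R) (d : nat -> R).

Lemma abel_mean_le r d N C : 0 <= r <= 1 -> (forall k, d k <= C) ->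
  abel_mean r d N <= C.
Proof.
move=> /andP[r0 r1]; elim: N d => //= N IH d dC.
have := IH (fun k => d k.+1) (fun k => dC k.+1).
have := dC 0; nra.
Qed.

(** Each of the first [n] weights is at most [1 - r], and the others sum to at most 1. The condition
    [n <= N] keeps the large last weight [r ^+ N] off the first [n] terms. *)
Lemma abel_mean_tail r d N n e C : 0 <= r <= 1 -> 0 <= C -> 0 <= e ->
  (forall k, d k <= C) -> (forall k, (n <= k)%N -> d k <= e) -> (n <= N)%N ->
  abel_mean r d N <= (1 - r) * (n%:R * C) + e.
Proof.
move=> r01 C0 e0; elim: n N d => [|n IH] [|N] d dC de nN //.
- by rewrite mul0r mulr0 add0r abel_mean_le// => k; exact: de.
- by rewrite mul0r mulr0 add0r abel_mean_le// => k; exact: de.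
have de' k : (n <= k)%N -> d k.+1 <= e by move=> nk; exact: de.
have := IH N (fun k => d k.+1) (fun k => dC k.+1) de' nN.
move: r01 => /andP[r0 r1] /=; have := dC 0.
have n0 : 0 <= n%:R * C by rewrite mulr_ge0.
rewrite -natr1 [(_ + 1) * C]mulrDl mul1r.
set A := abel_mean _ _ _; set B := n%:R * C in n0 *.
move=> d0C AB; have r1' : 0 <= 1 - r by rewrite subr_ge0.
have := ler_wpM2l r0 AB; have := ler_wpM2l r1' d0C.
by have := mulr_ge0 r1' (addr_ge0 (mulr_ge0 r1' n0) e0); lra.
Qed.

End AbelMeanReal.

(** * Squared modulus and componentwise convergence of complex numbers *)

Section SquaredModulus.
Context {R : realType}.
Implicit Types (z w : R[i]) (r : R).

Definition nsq z : R := complex.Re z ^+ 2 + complex.Im z ^+ 2.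

Lemma nsq_ge0 z : 0 <= nsq z.
Proof. by rewrite addr_ge0// sqr_ge0. Qed.

Lemma normc_sqrt z : ComplexField.Normc.normc z = Num.sqrt (nsq z).
Proof. by case: z. Qed.

Lemma normc_sqr z : ComplexField.Normc.normc z ^+ 2 = nsq z.
Proof. by rewrite normc_sqrt sqr_sqrtr// nsq_ge0. Qed.

Lemma nsqM z w : nsq (z * w) = nsq z * nsq w.
Proof. by case: z w => [a b] [x y]; rewrite /nsq/=; ring. Qed.

Lemma nsqN z : nsq (- z) = nsq z.
Proof. by case: z => [a b]; rewrite /nsq/=; ring. Qed.

(** By the parallelogram law, the two sides differ by [nsq (z - w)]. *)
Lemma nsqD_le z w : nsq (z + w) <= 2 * nsq z + 2 * nsq w.
Proof.
case: z w => [a b] [x y]; rewrite /nsq/=.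
have := sqr_ge0 (a - x); have := sqr_ge0 (b - y); nra.
Qed.

Lemma nsq_convex r z w : 0 <= r <= 1 ->
  nsq ((1 - r%:C%C) * z + r%:C%C * w) <= (1 - r) * nsq z + r * nsq w.
Proof.
move=> /andP[r0 r1]; case: z w => [a b] [x y]; rewrite /nsq/= -subr_ge0.
set D := (X in 0 <= X).
have -> : D = r * (1 - r) * ((a - x) ^+ 2 + (b - y) ^+ 2) by rewrite /D; ring.
by rewrite !mulr_ge0 ?subr_ge0// addr_ge0// sqr_ge0.
Qed.

Lemma nsq_expi n (t : R) : nsq (expi n t) = 1.
Proof. by rewrite /nsq/= cos2Dsin2. Qed.

Lemma cvg_complex (u : nat -> R[i]) (l : R[i]) :
  complex.Re (u n) @[n --> \oo] --> complex.Re l ->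
  complex.Im (u n) @[n --> \oo] --> complex.Im l ->
  (u n : R[i]^o) @[n --> \oo] --> (l : R[i]^o).
Proof.
move=> uRe uIm; apply/cvgrPdist_lt => -[e e'] e0.
(* In the order on [R[i]], a positive element is real, so the tolerance reduces to its real part. *)
have [{}e0 e'0] : 0 < e /\ e' = 0 by move: e0; rewrite ltcE/= => /andP[/eqP].
rewrite e'0 {e' e'0}; have e20 : 0 < e / 2 by rewrite divr_gt0.
move/cvgrPdist_lt : uRe => /(_ _ e20); move/cvgrPdist_lt : uIm => /(_ _ e20).
apply: filterS2 => n /=; case: l (u n) => [a b] [x y] /= hb ha.
rewrite normc_def ltcR/= -[ltRHS](ger0_norm (ltW e0)) -sqrtr_sqr.
rewrite ltr_sqrt ?exprn_gt0// -(real_normK (num_real (a - x))).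
rewrite -(real_normK (num_real (b - y))).
have := normr_ge0 (a - x); have := normr_ge0 (b - y); nra.
Qed.

End SquaredModulus.

(** * Symmetric sums, limits equal to zero, and power series *)

(** Grouping the indices [k] and [- k] turns a symmetric sum over the integers into an ordinary
    series; the index 0 is counted once. *)
Definition sympair {V : zmodType} (u : int -> V) (k : nat) : V :=
  if k is k'.+1 then u k%:Z + u (- k%:Z) else u 0.

Lemma symsumE {V : zmodType} (u : int -> V) M :
  symsum u M = \sum_(k < M.+1) sympair u k.
Proof.
elim: M => [|M IH]; first by rewrite /symsum big_nat1 big_ord1 subr0.
(* Both end terms, of indices [- M.+1] and [M.+1], are split off; what remains is the sum for [M],
   reindexed by one. *)
rewrite big_ord_recr/= -IH /symsum doubleS big_nat_recl// big_nat_recr//=.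
rewrite (eq_big_nat _ _ (F2 := fun k => u (k%:Z - M%:Z))) => [|k _]; last first.
  by congr u; lia.
have -> : M.*2.+2%:Z - M.+1%:Z = M.+1%:Z by lia.
by rewrite sub0r addrCA [u (- _) + _]addrC.
Qed.


Lemma cvge0P {I : Type} {F : set_system I} {FF : Filter F} {R : realType}
    (u : I -> \bar R) : (forall i, 0 <= u i)%E ->
  (u i @[i --> F] --> 0%E) <->
  (forall e : R, 0 < e -> \forall i \near F, (u i <= e%:E)%E).
Proof.
move=> u0; split=> [/fine_cvgP[ufin /cvgrPdist_le ucvg] e e0|ule].
  apply: (filterS2 _ _ ufin (ucvg _ e0)) => i ui /=.
  rewrite sub0r normrN ger0_norm ?fine_ge0// => ?.
  by rewrite -(fineK ui) lee_fin.
have ufin e i : (u i <= e%:E)%E -> u i \is a fin_num.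
  by move=> ui; rewrite ge0_fin_numE// (le_lt_trans ui)// ltry.
apply/fine_cvgP; split; first by apply: (filterS _ (ule 1 ltr01)) => i /ufin.
apply/cvgrPdist_le => e /ule; apply: filterS => i ui /=.
rewrite sub0r normrN ger0_norm ?fine_ge0//.
by rewrite -lee_fin fineK// (ufin _ _ ui).
Qed.

(** Absolute convergence, by comparison with the geometric series of ratio [r] and first term
    [K]. *)
Lemma is_cvg_bounded_pseries {R : realType} (r K : R) (a : nat -> R) : 0 <= r < 1 ->
  (forall k, `|a k| <= K) -> cvgn (fun N => \sum_(k < N.+1) r ^+ k * a k).
Proof.
move=> /andP[r0 r1] aK.
have -> : (fun N => \sum_(k < N.+1) r ^+ k * a k) =
    (fun N => series (fun k => r ^+ k * a k) N.+1).
  by apply/funext => N; rewrite /series/= big_mkord.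
suff /cvg_ex[l sl] : cvgn (series (fun k => r ^+ k * a k)).
  by apply/cvg_ex; exists l; rewrite (cvg_shiftS (series _)); exact: sl.
apply: normed_cvg.
apply: (@series_le_cvg _ _ (geometric K r)) => [k|k|k|] /=.
- by rewrite normr_ge0.
- by rewrite mulr_ge0 ?exprn_ge0// (le_trans _ (aK 0)).
- by rewrite normrM ger0_norm ?exprn_ge0// mulrC ler_wpM2r ?exprn_ge0.
- by apply: is_cvg_geometric_series; rewrite ger0_norm.
Qed.

(** * The squared norm of L^2: stability, convexity, Fatou *)

Section SquaredL2Norm.
Context {d : measure_display} {T : measurableType d} {R : realType}.
Variable mu : {measure set T -> \bar R}.
Implicit Types f h : T -> R[i].

(** Working with the square of [normL2] lets pointwise inequalities on [nsq] integrate directly. *)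
Definition sqL2 f : \bar R := (\int[mu]_t (nsq (f t))%:E)%E.

Definition measurableC f : Prop :=
  measurable_fun [set: T] (fun t => complex.Re (f t)) /\
  measurable_fun [set: T] (fun t => complex.Im (f t)).

Lemma sqL2_ge0 f : (0 <= sqL2 f)%E.
Proof. by apply: integral_ge0 => t _; rewrite lee_fin nsq_ge0. Qed.

Lemma normL2E f : normL2 mu f = sqrte (sqL2 f).
Proof.
rewrite /normL2 unlock -poweR12_sqrt ?sqL2_ge0//; congr (_ `^ _)%E.
apply: eq_integral => t _ /=.
by rewrite powR_mulrn// real_normK ?num_real// normc_sqr.
Qed.

Lemma normL2_le f (e : R) : 0 <= e ->
  (normL2 mu f <= e%:E)%E = (sqL2 f <= (e ^+ 2)%:E)%E.
Proof.
move=> e0; rewrite normL2E; have := sqL2_ge0 f; case: (sqL2 f) => [x||]//=.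
rewrite !lee_fin => x0.
by rewrite -[in LHS](ger0_norm e0) -sqrtr_sqr ler_sqrt// sqr_ge0.
Qed.

Lemma measurable_nsq f : measurableC f ->
  measurable_fun [set: T] (fun t => nsq (f t)).
Proof. by move=> [fr fi]; apply: measurable_funD; exact: measurable_funX. Qed.

Lemma measurableCN f : measurableC f -> measurableC (fun t => - f t).
Proof.
move=> [fr fi]; split; under eq_fun do rewrite raddfN; exact: measurable_funN.
Qed.

Lemma measurableCD f h : measurableC f -> measurableC h ->
  measurableC (fun t => f t + h t).
Proof.
move=> [fr fi] [hr hi].
by split; under eq_fun do rewrite raddfD; exact: measurable_funD.
Qed.

Lemma measurableCZ (c : R[i]) f : measurableC f -> measurableC (fun t => c * f t).
Proof.
move=> [fr fi].
have ReM (z w : R[i]) : complex.Re (z * w) =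
  complex.Re z * complex.Re w - complex.Im z * complex.Im w by case: z w => ? ? [].
have ImM (z w : R[i]) : complex.Im (z * w) =
  complex.Re z * complex.Im w + complex.Im z * complex.Re w by case: z w => ? ? [].
split.
  under eq_fun do rewrite ReM.
  by apply: measurable_funB; exact: measurable_funM.
under eq_fun do rewrite ImM.
by apply: measurable_funD; exact: measurable_funM.
Qed.

Lemma inL2P f : inL2 mu f <-> measurableC f /\ (sqL2 f < +oo)%E.
Proof.
rewrite /inL2 normL2E; have -> : (sqrte (sqL2 f) < +oo)%E = (sqL2 f < +oo)%E.
  by have := sqL2_ge0 f; case: sqL2 => [x||]//; rewrite /= !ltry.
by split=> [[]|[[]]].
Qed.

Lemma ge0_integralD_EFin (a b : R) (p q : T -> R) : 0 <= a -> 0 <= b ->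
  (forall t, 0 <= p t) -> (forall t, 0 <= q t) ->
  measurable_fun [set: T] p -> measurable_fun [set: T] q ->
  (\int[mu]_t (a * p t + b * q t)%:E =
   a%:E * \int[mu]_t (p t)%:E + b%:E * \int[mu]_t (q t)%:E)%E.
Proof.
move=> a0 b0 p0 q0 /measurable_EFinP mp /measurable_EFinP mq.
rewrite -!ge0_integralZl_EFin//; try by move=> t _; rewrite lee_fin.
rewrite -ge0_integralD//; first last.
- exact: measurable_funeM.
- by move=> t _; rewrite mule_ge0// lee_fin.
- exact: measurable_funeM.
- by move=> t _; rewrite mule_ge0// lee_fin.
Qed.

(** Common source of [sqL2D_le], with weights 2 and 2, and of [sqL2_convex], with weights [1 - r]
    and [r]. *)
Lemma sqL2_le_comb (a b : R) f h k : 0 <= a -> 0 <= b ->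
  measurableC f -> measurableC h -> measurableC k ->
  (forall t, nsq (k t) <= a * nsq (f t) + b * nsq (h t)) ->
  (sqL2 k <= a%:E * sqL2 f + b%:E * sqL2 h)%E.
Proof.
move=> a0 b0 mf mh mk kfh.
rewrite -ge0_integralD_EFin//; try exact: measurable_nsq;
  try by move=> t; exact: nsq_ge0.
apply: ge0_le_integral => //.
- by move=> t _; rewrite lee_fin nsq_ge0.
- by apply/measurable_EFinP/measurable_nsq.
- apply/measurable_EFinP; apply: measurable_funD; apply: measurable_funM => //;
    exact: measurable_nsq.
- by move=> t _; rewrite lee_fin.
Qed.

Lemma sqL2D_le f h : measurableC f -> measurableC h ->
  (sqL2 (fun t => f t + h t)%R <= 2%:E * sqL2 f + 2%:E * sqL2 h)%E.
Proof.
move=> mf mh; apply: sqL2_le_comb => //; first exact: measurableCD.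
by move=> t; exact: nsqD_le.
Qed.

Lemma inL2D f h : inL2 mu f -> inL2 mu h -> inL2 mu (fun t => f t + h t).
Proof.
move=> /inL2P[mf f2] /inL2P[mh h2]; apply/inL2P; split.
  exact: measurableCD.
rewrite (le_lt_trans (sqL2D_le _ _ mf mh))// lte_add_pinfty// lte_mul_pinfty//;
  exact: sqL2_ge0.
Qed.

Lemma inL2N f : inL2 mu f -> inL2 mu (fun t => - f t).
Proof.
move=> /inL2P[mf f2]; apply/inL2P; split; first exact: measurableCN.
by rewrite /sqL2; under eq_integral do rewrite nsqN.
Qed.

Lemma inL2Z c f : inL2 mu f -> inL2 mu (fun t => c * f t).
Proof.
move=> /inL2P[mf f2]; apply/inL2P; split; first exact: measurableCZ.
rewrite /sqL2; under eq_integral do rewrite nsqM EFinM.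
rewrite ge0_integralZl_EFin ?nsq_ge0//; first last.
- exact/measurable_EFinP/measurable_nsq.
- by move=> t _; rewrite lee_fin nsq_ge0.
by rewrite lte_mul_pinfty// lee_fin nsq_ge0.
Qed.

Lemma inL2_sum (u : nat -> T -> R[i]) N : (forall k, inL2 mu (u k)) ->
  inL2 mu (fun t => \sum_(k < N.+1) u k t).
Proof.
move=> uL2; elim: N => [|N IH]; first by under eq_fun do rewrite big_ord1.
by under eq_fun do rewrite big_ord_recr/=; exact: inL2D.
Qed.

Lemma inL2_symsum (u : int -> T -> R[i]) N : (forall n, inL2 mu (u n)) ->
  inL2 mu (fun t => symsum (u^~ t) N).
Proof.
move=> uL2; under eq_fun do rewrite symsumE.
apply: (inL2_sum (fun k t => sympair (u^~ t) k)) => -[|k].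
  exact: uL2.
exact: (inL2D _ _ (uL2 _) (uL2 _)).
Qed.

Lemma inL2_abel_mean (r : R[i]) (u : nat -> T -> R[i]) N :
  (forall k, inL2 mu (u k)) -> inL2 mu (fun t => abel_mean r (u^~ t) N).
Proof.
elim: N u => [|N IH] u uL2 //=.
by apply: inL2D; apply: inL2Z => //; exact: (IH (fun k => u k.+1)).
Qed.

Lemma sqL2_convex (r : R) f h : 0 <= r <= 1 -> measurableC f -> measurableC h ->
  (sqL2 (fun t => (1 - r%:C%C) * f t + r%:C%C * h t)%R <=
   (1 - r)%:E * sqL2 f + r%:E * sqL2 h)%E.
Proof.
move=> r01 mf mh; have /andP[r0 r1] := r01.
apply: sqL2_le_comb; rewrite ?subr_ge0//.
  by apply: measurableCD; exact: measurableCZ.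
by move=> t; exact: nsq_convex.
Qed.

(** Jensen's inequality for the Abel weights: each step of the recursion is one two-point convexity
    inequality. Membership in L^2 makes every [fine] faithful. *)
Lemma sqL2_abel_mean r (u : nat -> T -> R[i]) N : 0 <= r <= 1 ->
  (forall k, inL2 mu (u k)) ->
  (sqL2 (fun t => abel_mean r%:C%C (u^~ t) N) <=
   (abel_mean r (fun k => fine (sqL2 (u k))) N)%:E)%E.
Proof.
move=> r01; have /andP[r0 r1] := r01.
elim: N u => [|N IH] u uL2 /=; have u0fin : sqL2 (u 0) \is a fin_num by
  rewrite ge0_fin_numE ?sqL2_ge0//; have /inL2P[] := uL2 0.
  by rewrite fineK.
have uSL2 k : inL2 mu (u k.+1) by [].
have [mu0 _] := (inL2P _).1 (uL2 0).
have [mu' _] := (inL2P _).1 (inL2_abel_mean r%:C%C (fun k => u k.+1) N uSL2).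
rewrite (le_trans (sqL2_convex _ _ _ r01 mu0 mu'))// [leRHS]EFinD !EFinM fineK//.
rewrite leeD2l// lee_wpmul2l ?lee_fin//.
exact: (IH (fun k => u k.+1)).
Qed.

Lemma sqL2_fatou (u : nat -> T -> R[i]) f (e : R) :
  (forall n, measurableC (u n)) ->
  (forall t, complex.Re (u n t) @[n --> \oo] --> complex.Re (f t)) ->
  (forall t, complex.Im (u n t) @[n --> \oo] --> complex.Im (f t)) ->
  (\forall n \near \oo, (sqL2 (u n) <= e%:E)%E) ->
  measurableC f /\ (sqL2 f <= e%:E)%E.
Proof.
move=> mu_ uRe uIm ule; split.
  split.
    by apply: measurable_fun_cvg (fun n => (mu_ n).1) _ => t _; exact: uRe.
  by apply: measurable_fun_cvg (fun n => (mu_ n).2) _ => t _; exact: uIm.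
have nsq_lim t : (nsq (u n t))%:E @[n --> \oo] --> (nsq (f t))%:E.
  apply: cvg_EFin; first exact: nearW.
  by apply: cvgD; rewrite expr2; apply: cvgM.
(* The integrand is written as a lower limit, the form in which Fatou's lemma applies. *)
rewrite /sqL2; under eq_integral do rewrite -(cvg_limn_einf_sup (nsq_lim _)).1.
apply: (le_trans (fatou _ _ _ _)) => //.
- by move=> n; apply/measurable_EFinP/measurable_nsq.
- by move=> n t _; rewrite lee_fin nsq_ge0.
(* The lower limit is the limit of the infima over tails, and each infimum is at most the first term
   of its tail. *)
rewrite limn_einf_lim; apply: lime_le; first exact: is_cvg_einfs.
apply: filterS ule => n; apply: le_trans.
by apply: ereal_inf_lbound; exists n => /=.
Qed.

End SquaredL2Norm.

(** * Abel summability in L^2 *)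

Section AbelSummability.
Context {d : measure_display} {T : measurableType d} {R : realType}.
Variable mu : {measure set T -> \bar R}.
Implicit Types (c : int -> R[i]) (x : int -> T -> R[i]).

Definition psum c x (r : R) (N : nat) (t : T) : R[i] :=
  symsum (fun n => c n * (r ^+ `|n|%N)%:C%C * x n t) N.

Lemma psum_sympair c x r N t : psum c x r N t =
  \sum_(k < N.+1) (r%:C%C) ^+ k * sympair (fun n => c n * x n t) k.
Proof.
rewrite /psum symsumE; apply: eq_bigr => -[[|k] kN] _ /=.
  by rewrite expr0 mul1r mulr1.
by rewrite rmorphXn/=; ring.
Qed.

Lemma psum_abel_mean c x r N t : psum c x r N t =
  abel_mean r%:C%C (symsum (fun n => c n * x n t)) N.
Proof.
rewrite psum_sympair abel_mean_sum; congr abel_mean.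
by apply/funext => M; rewrite symsumE.
Qed.

(** Since [lim] has a default value on divergent sequences, actual convergence must be proved. Real
    and imaginary parts are power series in [r] with bounded coefficients. *)
Lemma psum_cvg c x (C r : R) t : 0 <= r < 1 ->
  (forall n, nsq (c n * x n t) <= C) ->
  let A : R[i] := lim ((psum c x r N t : R[i]^o) @[N --> \oo]) in
  complex.Re (psum c x r N t) @[N --> \oo] --> complex.Re A /\
  complex.Im (psum c x r N t) @[N --> \oo] --> complex.Im A.
Proof.
move=> r01 cC A.
set a := sympair (fun n => c n * x n t).
have C0 : 0 <= C by rewrite (le_trans _ (cC 0)) ?nsq_ge0.
have a4C k : nsq (a k) <= 4 * C.
  case: k => [|k] /=; first by rewrite (le_trans (cC 0))//; lra.
  rewrite (le_trans (nsqD_le _ _))//.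
  by have := cC k.+1%:Z; have := cC (- k.+1%:Z); lra.
have ReP N : complex.Re (psum c x r N t) = \sum_(k < N.+1) r ^+ k * complex.Re (a k).
  rewrite psum_sympair raddf_sum; apply: eq_bigr => k _.
  by rewrite -/a -rmorphXn/=; case: (a k) => ? ?/=; rewrite mul0r subr0.
have ImP N : complex.Im (psum c x r N t) = \sum_(k < N.+1) r ^+ k * complex.Im (a k).
  rewrite psum_sympair raddf_sum; apply: eq_bigr => k _.
  by rewrite -/a -rmorphXn/=; case: (a k) => ? ?/=; rewrite mul0r addr0.
(* A bound without square roots, from [|y| <= 1 + y ^+ 2]. *)
have sqr_bound (y : R) : y ^+ 2 <= 4 * C -> `|y| <= 1 + 4 * C.
  by rewrite -real_normK ?num_real//; have := normr_ge0 y; nra.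
have /cvg_ex[lr lrP] : cvgn (fun N => complex.Re (psum c x r N t)).
  under eq_fun do rewrite ReP.
  apply: (is_cvg_bounded_pseries _ (1 + 4 * C) (fun k => complex.Re (a k))) => // k.
  by apply: sqr_bound; rewrite (le_trans _ (a4C k))// lerDl sqr_ge0.
have /cvg_ex[li liP] : cvgn (fun N => complex.Im (psum c x r N t)).
  under eq_fun do rewrite ImP.
  apply: (is_cvg_bounded_pseries _ (1 + 4 * C) (fun k => complex.Im (a k))) => // k.
  by apply: sqr_bound; rewrite (le_trans _ (a4C k))// lerDr sqr_ge0.
have -> : A = (lr +i* li)%C.
  exact: (cvg_lim (@norm_hausdorff _ (R[i]^o)) (cvg_complex _ (lr +i* li)%C lrP liP)).
by [].
Qed.

(** Abel's theorem in L^2. The pointwise bound [C] yields the limit in [N] at every point; the norm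
    estimate comes from the convergence of the symmetric sums. *)
Lemma abel_summability (c : int -> R[i]) (x : int -> T -> R[i]) f (C : R) :
  (forall n, inL2 mu (x n)) -> (forall n t, nsq (c n * x n t) <= C) ->
  cvgL2 mu \oo (fun M t => symsum (fun n => c n * x n t) M) f ->
  cvgL2 mu (1 : R)^'-
    (fun r t => lim ((psum c x r N t : R[i]^o) @[N --> \oo])) f.
Proof.
move=> xL2 cC [_ fL2 Sf].
pose D M t := symsum (fun n => c n * x n t) M - f t.
have DL2 M : inL2 mu (D M).
  apply: inL2D; last exact: inL2N.
  by apply: (inL2_symsum _ (fun n t => c n * x n t)) => n; exact: inL2Z.
have Dfin M : sqL2 mu (D M) \is a fin_num.
  by rewrite ge0_fin_numE ?sqL2_ge0//; have /inL2P[] := DL2 M.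
pose s M := fine (sqL2 mu (D M)).
have s0 M : 0 <= s M by rewrite fine_ge0// sqL2_ge0.
have normL2_ge0 h : (0 <= normL2 mu h)%E by exact: Lnorm_ge0.
have s_small (e : R) : 0 < e -> \forall M \near \oo, s M <= e ^+ 2.
  move=> e0; apply: filterS ((cvge0P _ (fun=> normL2_ge0 _)).1 Sf _ e0) => M /=.
  by rewrite (normL2_le _ _ _ (ltW e0)) -(fineK (Dfin M)) lee_fin.
have [K K0 sK] : exists2 K, 0 <= K & forall M, s M <= K.
  (* A convergent sequence is bounded: from [N] on by 1, and before [N] by the sum of the finitely
     many values. *)
  have [N _ sN] := s_small 1 ltr01.
  exists (1 + \sum_(k < N) s k) => [|M]; first by rewrite addr_ge0// sumr_ge0.
  have [MN|NM] := ltnP M N; last first.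
    by rewrite (le_trans (sN M NM))// expr1n lerDl sumr_ge0.
  by rewrite (bigD1 (Ordinal MN))//= addrCA lerDl addr_ge0// sumr_ge0.
pose A r t : R[i] := lim ((psum c x r N t : R[i]^o) @[N --> \oo]).
(* Fatou's lemma on [psum r N - f], an Abel mean of the [D M] *)
have Abound r e N0 : 0 <= r < 1 -> 0 <= e ->
    (forall M, (N0 <= M)%N -> s M <= e) ->
    measurableC (fun t => A r t - f t) /\
    (sqL2 mu (fun t => A r t - f t)%R <= ((1 - r) * (N0%:R * K) + e)%:E)%E.
  move=> r01 e0 se.
  have r01' : 0 <= r <= 1 by case/andP: r01 => -> /ltW.
  have PD N : (fun t => psum c x r N t - f t) =
      (fun t => abel_mean r%:C%C (D^~ t) N).
    (* As the weights sum to 1, [f t] may be subtracted inside the mean. *)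
    apply/funext => t; rewrite psum_abel_mean addrC -abel_meanDl.
    by congr abel_mean; apply/funext => M; rewrite addrC.
  apply: (sqL2_fatou _ (fun N t => psum c x r N t - f t)) => [N|t|t|].
  - by rewrite PD; have /inL2P[] := inL2_abel_mean mu r%:C%C D N DL2.
  - rewrite raddfB; under eq_fun do rewrite raddfB.
    by apply: cvgB; [exact: (psum_cvg _ _ _ _ _ r01 (cC^~ t)).1|exact: cvg_cst].
  - rewrite raddfB; under eq_fun do rewrite raddfB.
    by apply: cvgB; [exact: (psum_cvg _ _ _ _ _ r01 (cC^~ t)).2|exact: cvg_cst].
  exists N0 => // N /= N0N; rewrite PD (le_trans (sqL2_abel_mean _ _ _ _ r01' DL2))//.
  by rewrite lee_fin abel_mean_tail.
have near01 : \forall r \near (1 : R)^'-, 0 <= r < 1.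
  near=> r; apply/andP; split; last by near: r; exact: nbhs_left_lt.
  by near: r; apply: nbhs_left_ge.
split => //.
- apply: filterS near01 => r r01.
  (* Only finiteness is at stake here, so the tolerance 1 suffices. *)
  have [N0 _ sN0] := s_small 1 ltr01.
  have [mA Ale] := Abound r _ N0 r01 (sqr_ge0 1) sN0.
  have AfL2 : inL2 mu (fun t => A r t - f t).
    by apply/inL2P; split => //; rewrite (le_lt_trans Ale)// ltry.
  have := inL2D _ _ _ AfL2 fL2; under eq_fun do rewrite subrK.
  exact.
apply/cvge0P => // e e0.
have e20 : 0 < e / 2 by rewrite divr_gt0.
have [N0 _ sN0] := s_small _ e20.
(* The [+ 1] keeps the later divisor positive even when [N0%:R * K] is 0. *)
have B0 : 0 < N0%:R * K + 1 by rewrite ltr_wpDl// mulr_ge0.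
near=> r.
have r01 : 0 <= r < 1 by near: r.
have [_ Ale] := Abound r _ N0 r01 (sqr_ge0 _) sN0.
rewrite (normL2_le _ _ _ (ltW e0)) (le_trans Ale)// lee_fin.
(* This makes both terms of [Abound] at most [(e / 2) ^+ 2], with sum below [e ^+ 2]. *)
have : 1 - r <= (e / 2) ^+ 2 / (N0%:R * K + 1).
  rewrite lerBlDr -lerBlDl; near: r; apply: nbhs_left_ge.
  by rewrite ltrBlDr ltrDl divr_gt0// exprn_gt0.
rewrite ler_pdivlMr// => hr.
have r1 : 0 <= 1 - r by case/andP: r01 => _ /ltW; rewrite subr_ge0.
by have := sqr_ge0 e; nra.
Unshelve. all: by end_near. Qed.

End AbelSummability.

(** * Bessel coefficients, exponentials and the conclusion *)

(** One term of a nonnegative sum is at most the whole, here at most [B] times the squared norm of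
    [f]. *)
Lemma bessel_coef_bounded {d : measure_display} {T : measurableType d}
    {R : realType} (mu : {measure set T -> \bar R}) (g : int -> T -> R[i]) f :
  bessel mu g -> inL2 mu f ->
  exists C : R, forall n, nsq (innerL2 mu f (g n)) <= C.
Proof.
move=> [B B0 gB] fL2; have [_ _ foo] := fL2; have := gB _ fL2.
have f0 : (0 <= normL2 mu f)%E by exact: Lnorm_ge0.
rewrite -(fineK (x := normL2 mu f)) ?ge0_fin_numE// -EFin_expe -EFinM.
set C := B * _ => gC; exists C => n; rewrite -lee_fin (le_trans _ gC)//.
apply: esum_ge; exists [set n]; first by split => //; exact: finite_set1.
by rewrite fsbig_set1 normc_sqr.
Qed.

(** The exponentials have modulus 1, so their squared norm is the total mass of [mu], which is
    finite. *)
Lemma inL2_expi {R : realType} (mu : {finite_measure set R -> \bar R}) n :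
  inL2 mu (@expi R n).
Proof.
apply/inL2P; split.
  split; apply: measurableT_comp => //; apply: continuous_measurable_fun.
    exact: continuous_cos.
  exact: continuous_sin.
rewrite /sqL2; under eq_integral do rewrite nsq_expi.
by rewrite integral_cst// mul1e -ge0_fin_numE// fin_num_measure.
Qed.

Theorem theorem5p10 (R : realType) (mu : {finite_measure set R -> \bar R})
    (mu_supp : mu (~` `[0, 1[) = 0%E)
    (g : int -> R -> R[i])
    (gL2 : forall n, inL2 mu (g n))
    (g_bessel : bessel mu g)
    (g_dextrodual : dextrodual mu g (@expi R))
    (f : R -> R[i]) (fL2 : inL2 mu f) :
  cvgL2 mu (1 : R)^'- (fun r t => Amap mu g f r t) f.
Proof.
have [C cC] := bessel_coef_bounded mu g f g_bessel fL2.
apply: (abel_summability mu _ _ f C (inL2_expi mu) _ (g_dextrodual f fL2)).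
(* Unimodularity turns the coefficient bound into one uniform in [n] and [t]. *)
by move=> n t; rewrite nsqM nsq_expi mulr1.
Qed.
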